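(* Let $\Omega=\mathbb{R}\times(0,\pi)$, let $f:\Omega\to\mathbb{R}$ and $g,h:\mathbb{R}\to\mathbb{R}$ be continuous, and let $k$ be an arbitrary real constant. If $\lambda\ge 0$, then the problem $$\begin{cases}\Delta u - k u_x - \lambda u = f(x,y) & \text{in } \Omega,\\ u(x,0)=g(x),\quad u(x,\pi)=h(x), & x\in\mathbb{R},\end{cases}$$ has at most one solution in the class $$\left\{u\in C^2(\Omega)\cap C(\overline{\Omega}) \;:\; \lim_{\sqrt{x^2+y^2}\to+\infty}\frac{u(x,y)}{\sqrt{x^2+y^2}}=0\right\}.$$ In particular, there is at most one solution in the class $C^2(\Omega)\cap C_b(\overline{\Omega})$.
   Context: Here $(x,y)$ are the Cartesian coordinates in $\mathbb{R}^2$, $u_x=\partial u/\partial x$ and $\Delta=\partial_x^2+\partial_y^2$. Functions are real-valued. The limit in the definition of the class is taken over points $(x,y)\in\overline{\Omega}=\mathbb{R}\times[0,\pi]$. $C_b(\overline{\Omega})$ denotes the space of bounded continuous functions on $\overline{\Omega}$. *)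

(* Defs.v *)
From Stdlib Require Import Reals.
From Coquelicot Require Import Coquelicot.
Open Scope R_scope.

(* Functions on the strip are total functions R -> R -> R; only their values
   on the closed strip matter, and "unique" means equal there. *)

Definition Omega (p : R * R) : Prop := 0 < snd p < PI.

Definition Omega_bar (p : R * R) : Prop := 0 <= snd p <= PI.

Definition continuous_on_2d (D : R * R -> Prop) (u : R -> R -> R) : Prop :=
  continuous_on D (fun p : R * R => u (fst p) (snd p)).

(* [ex_diff_n u 2 x y] says that the partial derivatives of u of order at most
   2 exist and are continuous at (x, y); since [Omega] is open, requiring it at
   every point of [Omega] is membership in C^2(Omega). *)
Definition C2_Omega (u : R -> R -> R) : Prop :=
  forall x y : R, Omega (x, y) -> ex_diff_n u 2 x y.

Definition sublinear_at_infinity (u : R -> R -> R) : Prop :=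
  forall eps : R, 0 < eps ->
    exists M : R, forall x y : R,
      Omega_bar (x, y) -> M < sqrt (x ^ 2 + y ^ 2) ->
      Rabs (u x y / sqrt (x ^ 2 + y ^ 2)) < eps.

Definition bounded_on_2d (D : R * R -> Prop) (u : R -> R -> R) : Prop :=
  exists M : R, forall x y : R, D (x, y) -> Rabs (u x y) <= M.

Definition sublinear_class (u : R -> R -> R) : Prop :=
  C2_Omega u /\ continuous_on_2d Omega_bar u /\ sublinear_at_infinity u.

Definition bounded_class (u : R -> R -> R) : Prop :=
  C2_Omega u /\ continuous_on_2d Omega_bar u /\ bounded_on_2d Omega_bar u.

Definition Laplacian (u : R -> R -> R) (x y : R) : R :=
  partial_derive 2 0 u x y + partial_derive 0 2 u x y.

Definition solves (k lambda : R) (f : R -> R -> R) (g h : R -> R)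
    (u : R -> R -> R) : Prop :=
  (forall x y : R, Omega (x, y) ->
     Laplacian u x y - k * partial_derive 1 0 u x y - lambda * u x y = f x y) /\
  (forall x : R, u x 0 = g x /\ u x PI = h x).

Definition at_most_one_in (C P : (R -> R -> R) -> Prop) : Prop :=
  forall u v : R -> R -> R, C u -> P u -> C v -> P v ->
    forall x y : R, Omega_bar (x, y) -> u x y = v x y.

(* Main.v *)
Require Import Defs.
From Stdlib Require Import Reals.
From Coquelicot Require Import Coquelicot.
From Stdlib Require Import Lra ClassicalEpsilon.
Open Scope R_scope.

(** The difference of two solutions satisfies the homogeneous equation with
    zero boundary values, so uniqueness is a maximum principle for the operator
    [L w = w_xx + w_yy - k w_x - lambda w]. On an unbounded strip the
    supremum of [w] need not be attained; a barrier (Phragmen-Lindeloef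
    argument) repairs this. The function
      [phi (x, y) = sqrt (1 + x^2) + (1 + |k|) y (PI - y)]
    is positive, satisfies [L phi < 0] because the constant concavity
    [-2 (1 + |k|)] in [y] beats the bounded contributions [phi_xx <= 1] and
    [|k phi_x| <= |k|], and grows linearly in [x] ([barrier_strict],
    [dist_le_barrier]).

    Let [w = u - v] be sublinear with [L w >= 0] inside and [w <= 0] on the
    two boundary lines, and suppose that [w > 0] somewhere. For small
    [eps > 0] the function [w - eps phi] is still positive there, but it is
    negative on the boundary lines and for large [|x|]. It therefore has a
    positive maximum over a rectangle ([rectangle_max_attained]), reached at an
    interior point. There the first derivatives vanish and the pure second
    derivatives are nonpositive ([second_derivative_at_max]), and with
    [lambda >= 0] this gives [L (w - eps phi) <= 0]. But
    [L (w - eps phi) >= - eps L phi > 0], a contradiction. This is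
    [comparison]; uniqueness follows by exchanging the two solutions, and the
    bounded class lies inside the sublinear one. *)

(** * Attained maxima *)

Definition clamp (a b x : R) : R := Rmax a (Rmin x b).

Lemma clamp_range (a b x : R) : a <= b -> a <= clamp a b x <= b.
Proof.
  intros H; unfold clamp, Rmax, Rmin; repeat destruct Rle_dec; lra.
Qed.

Lemma clamp_id (a b x : R) : a <= x <= b -> clamp a b x = x.
Proof.
  intros H; unfold clamp, Rmax, Rmin; repeat destruct Rle_dec; lra.
Qed.

Lemma clamp_lipschitz (a b x y : R) :
  a <= b -> Rabs (clamp a b x - clamp a b y) <= Rabs (x - y).
Proof.
  intros H; unfold clamp, Rmax, Rmin, Rabs;
    repeat destruct Rle_dec; repeat destruct Rcase_abs; lra.
Qed.

Definition rectangle (a b c d : R) (p : R * R) : Prop :=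
  a <= fst p <= b /\ c <= snd p <= d.

(** Composing with the retraction onto the rectangle turns one-sided continuity
    at its edges into continuity on the whole plane. *)
Lemma continuity_2d_clamp (F : R -> R -> R) (a b c d : R) :
  a <= b -> c <= d ->
  continuous_on_2d (rectangle a b c d) F ->
  forall x y, continuity_2d_pt (fun s t => F (clamp a b s) (clamp c d t)) x y.
Proof.
  intros Hab Hcd HF x y eps.
  assert (HD : rectangle a b c d (clamp a b x, clamp c d y)).
  { split; apply clamp_range; assumption. }
  specialize (HF _ HD).
  apply (proj1 (filterlim_locally _ _)) with (eps := eps) in HF.
  destruct HF as [del Hdel].
  exists del; intros s t Hs Ht.
  apply (Hdel (clamp a b s, clamp c d t)).
  - split; simpl.
    + apply Rle_lt_trans with (2 := Hs), clamp_lipschitz; assumption.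
    + apply Rle_lt_trans with (2 := Ht), clamp_lipschitz; assumption.
  - split; apply clamp_range; assumption.
Qed.

Lemma continuity_2d_pt_slice (F : R -> R -> R) (x y : R) :
  continuity_2d_pt F x y -> continuity_pt (F x) y.
Proof.
  intros H.
  apply continuity_pt_filterlim, filterlim_locally; intros eps.
  destruct (H eps) as [del Hdel]; exists del; intros t Ht.
  apply Hdel; [|exact Ht].
  rewrite Rminus_diag, Rabs_R0; apply cond_pos.
Qed.

(** Maximise in [y] for each [x], then in [x]: uniform continuity makes the
    partial maximum a continuous function of [x]. *)
Lemma rectangle_max_attained (F : R -> R -> R) (a b c d : R) :
  a <= b -> c <= d ->
  continuous_on_2d (rectangle a b c d) F ->
  exists x0 y0, a <= x0 <= b /\ c <= y0 <= d /\
    forall x y, a <= x <= b -> c <= y <= d -> F x y <= F x0 y0.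
Proof.
  intros Hab Hcd HF.
  pose (G := fun s t => F (clamp a b s) (clamp c d t)).
  assert (HG : forall x y, continuity_2d_pt G x y).
  { apply continuity_2d_clamp; assumption. }
  assert (Hmax : forall x, exists y,
    (forall t, c <= t <= d -> G x t <= G x y) /\ c <= y <= d).
  { intros x; apply (continuity_ab_maj (G x)); [assumption|].
    intros t _; apply continuity_2d_pt_slice, HG. }
  pose (Y := fun x => proj1_sig (constructive_indefinite_description _ (Hmax x))).
  assert (HY : forall x,
    (forall t, c <= t <= d -> G x t <= G x (Y x)) /\ c <= Y x <= d).
  { intros x; exact (proj2_sig (constructive_indefinite_description _ (Hmax x))). }
  destruct (continuity_ab_maj (fun x => G x (Y x)) a b Hab) as [x0 [Hx0 Hx0r]].
  { intros x Hx.
    apply continuity_pt_filterlim, filterlim_locally; intros eps.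
    (* One unit of margin lets a two-sided neighbourhood of [a] or [b] stay
       inside the region of uniform continuity. *)
    destruct (uniform_continuity_2d G (a - 1) (b + 1) c d) with (eps := eps)
      as [del Hdel].
    { intros; apply HG. }
    assert (Hm : 0 < Rmin del 1).
    { apply Rmin_pos; [apply cond_pos | lra]. }
    exists (mkposreal _ Hm); intros s Hs.
    change (Rabs (s - x) < Rmin del 1) in Hs.
    change (Rabs (G s (Y s) - G x (Y x)) < eps).
    pose proof (Rmin_l del 1) as Hl; pose proof (Rmin_r del 1) as Hr.
    assert (Hs1 : a - 1 <= s <= b + 1).
    { apply Rabs_lt_between' in Hs; lra. }
    assert (Hu : forall t, c <= t <= d -> Rabs (G s t - G x t) < eps).
    { intros t Ht; apply Hdel; try lra.
      rewrite Rminus_diag, Rabs_R0; apply cond_pos. }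
    destruct (HY s) as [Ms Rs]; destruct (HY x) as [Mx Rx].
    pose proof (Hu _ Rs) as H1; pose proof (Hu _ Rx) as H2.
    specialize (Ms _ Rx); specialize (Mx _ Rs).
    apply Rabs_lt_between in H1; apply Rabs_lt_between in H2.
    apply Rabs_lt_between; lra. }
  exists x0, (Y x0).
  destruct (HY x0) as [_ HY0].
  split; [assumption | split; [assumption |]].
  intros x y Hx Hy.
  assert (E : forall s t, a <= s <= b -> c <= t <= d -> G s t = F s t).
  { intros s t Hs Ht; unfold G; rewrite !clamp_id; auto. }
  rewrite <- !E by assumption.
  apply Rle_trans with (G x (Y x)); [apply HY; assumption | apply Hx0; assumption].
Qed.

(** If the second derivative were positive, the first derivative, which vanishes
    at the maximum, would be positive just to the right of it, and the function
    would increase there. *)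
Lemma second_derivative_at_max (g dg : R -> R) (c l : R) :
  locally c (fun t => is_derive g t (dg t)) ->
  is_derive dg c l ->
  locally c (fun t => g t <= g c) ->
  dg c = 0 /\ l <= 0.
Proof.
  intros Hg Hdg Hc.
  assert (Hcrit : dg c = 0).
  { pose proof (locally_singleton _ _ Hg) as Hgc.
    destruct Hc as [r Hr].
    apply is_derive_Reals in Hgc.
    transitivity (derive_pt g c (exist _ _ Hgc)); [reflexivity|].
    pose proof (cond_pos r).
    apply deriv_maximum with (a := c - r) (b := c + r); try lra.
    intros x H1 H2; apply Hr, Rabs_lt_between'; lra. }
  split; [assumption|].
  destruct (Rle_or_lt l 0) as [|Hl]; [assumption | exfalso].
  apply is_derive_Reals in Hdg.
  destruct (Hdg l Hl) as [r1 Hr1].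
  destruct Hg as [r2 Hr2]; destruct Hc as [r3 Hr3].
  pose (h := Rmin r1 (Rmin r2 r3) / 2).
  assert (Hh : 0 < h /\ h < r1 /\ h < r2 /\ h < r3).
  { pose proof (cond_pos r1); pose proof (cond_pos r2); pose proof (cond_pos r3).
    unfold h, Rmin; repeat destruct Rle_dec; lra. }
  assert (Hpos : forall t, c < t <= c + h -> 0 < dg t).
  { intros t Ht.
    assert (Hq : Rabs ((dg (c + (t - c)) - dg c) / (t - c) - l) < l).
    { apply Hr1; [lra | rewrite Rabs_pos_eq; lra]. }
    replace (c + (t - c)) with t in Hq by ring.
    rewrite Hcrit, Rminus_0_r in Hq.
    apply Rabs_lt_between in Hq.
    replace (dg t) with (dg t / (t - c) * (t - c)) by (field; lra).
    apply Rmult_lt_0_compat; lra. }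
  assert (Hder : forall t, c <= t <= c + h -> is_derive g t (dg t)).
  { intros t Ht; apply Hr2, Rabs_lt_between'; lra. }
  destruct (MVT_cor2 g dg c (c + h)) as [xi [Hxi Hxr]]; [lra | |].
  { intros t Ht; apply is_derive_Reals, Hder, Ht. }
  assert (Hle : g (c + h) <= g c).
  { apply Hr3, Rabs_lt_between'; lra. }
  assert (Hxp : 0 < dg xi) by (apply Hpos; lra).
  assert (0 < dg xi * (c + h - c)) by (apply Rmult_lt_0_compat; lra).
  lra.
Qed.

(** * The barrier *)

Definition barrier (k x y : R) : R :=
  sqrt (1 + x ^ 2) + (1 + Rabs k) * (y * (PI - y)).

Lemma sqrt_1_sqr_ge_1 (x : R) : 1 <= sqrt (1 + x ^ 2).
Proof.
  rewrite <- sqrt_1 at 1; apply sqrt_le_1_alt.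
  pose proof (pow2_ge_0 x); lra.
Qed.

Lemma sqrt_le_barrier (k x y : R) :
  Omega_bar (x, y) -> sqrt (1 + x ^ 2) <= barrier k x y.
Proof.
  intros [H0 H1]; cbn [snd] in *; unfold barrier.
  pose proof (Rabs_pos k).
  assert (0 <= (1 + Rabs k) * (y * (PI - y))).
  { apply Rmult_le_pos; [lra | apply Rmult_le_pos; lra]. }
  lra.
Qed.

Lemma barrier_pos (k x y : R) : Omega_bar (x, y) -> 0 < barrier k x y.
Proof.
  intros H; pose proof (sqrt_le_barrier k x y H).
  pose proof (sqrt_1_sqr_ge_1 x); lra.
Qed.

(** The height of the strip is at most 4, so [x^2 + y^2 <= 16 (1 + x^2)]. *)
Lemma dist_le_barrier (k x y : R) :
  Omega_bar (x, y) -> sqrt (x ^ 2 + y ^ 2) <= 4 * barrier k x y.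
Proof.
  intros H.
  apply Rle_trans with (4 * sqrt (1 + x ^ 2)).
  - destruct H as [H0 H1]; cbn [snd] in *.
    pose proof PI_4.
    rewrite <- (sqrt_square 4) by lra.
    rewrite <- sqrt_mult_alt by lra.
    apply sqrt_le_1_alt.
    assert (y * y <= 4 * 4) by (apply Rmult_le_compat; lra).
    pose proof (pow2_ge_0 x); lra.
  - pose proof (sqrt_le_barrier k x y H); lra.
Qed.

Definition barrier_x (x : R) : R := x / sqrt (1 + x ^ 2).

Definition barrier_xx (x : R) : R := / sqrt (1 + x ^ 2) ^ 3.

Definition barrier_y (k y : R) : R := (1 + Rabs k) * (PI - 2 * y).

Lemma is_derive_barrier_x (k x y : R) :
  is_derive (fun t => barrier k t y) x (barrier_x x).
Proof.
  unfold barrier, barrier_x.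
  pose proof (sqrt_1_sqr_ge_1 x); pose proof (pow2_ge_0 x).
  auto_derive; simpl in *; [lra | field; lra].
Qed.

Lemma is_derive_barrier_xx (x : R) : is_derive barrier_x x (barrier_xx x).
Proof.
  unfold barrier_x, barrier_xx.
  pose proof (sqrt_1_sqr_ge_1 x) as Hs; pose proof (pow2_ge_0 x) as Hx.
  auto_derive; simpl in *; [split; [|split]; lra|].
  pose proof (sqrt_sqrt (1 + x * (x * 1))) as Hq.
  set (s := sqrt (1 + x * (x * 1))) in *.
  assert (E : x * x = s * s - 1) by (rewrite Hq; lra).
  field_simplify; try lra.
  replace (x ^ 2) with (s ^ 2 - 1) by (simpl; lra).
  field; lra.
Qed.

Lemma is_derive_barrier_y (k x y : R) :
  is_derive (fun t => barrier k x t) y (barrier_y k y).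
Proof. unfold barrier, barrier_y; auto_derive; [exact I | ring]. Qed.

Lemma is_derive_barrier_yy (k y : R) :
  is_derive (barrier_y k) y (- 2 * (1 + Rabs k)).
Proof. unfold barrier_y; auto_derive; [exact I | ring]. Qed.

(** [|phi_x| <= 1] and [phi_xx <= 1], so the [x]-terms contribute at most
    [1 + |k|], half of what the [y]-concavity takes away. *)
Lemma barrier_strict (k lambda x y : R) :
  0 <= lambda -> Omega_bar (x, y) ->
  barrier_xx x + - 2 * (1 + Rabs k) - k * barrier_x x
    - lambda * barrier k x y < 0.
Proof.
  intros Hl Ho.
  pose proof (sqrt_1_sqr_ge_1 x) as Hs.
  assert (Hxx : barrier_xx x <= 1).
  { unfold barrier_xx.
    apply Rle_trans with (/ 1); [apply Rinv_le_contravar; [lra|] | lra].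
    apply pow_R1_Rle; assumption. }
  assert (Hx : Rabs (barrier_x x) <= 1).
  { unfold barrier_x.
    rewrite Rabs_div by lra.
    rewrite (Rabs_pos_eq (sqrt _)) by lra.
    apply Rle_div_l; [lra|].
    rewrite Rmult_1_l, <- sqrt_Rsqr_abs.
    apply sqrt_le_1_alt; unfold Rsqr; simpl; lra. }
  assert (Hk : - (k * barrier_x x) <= Rabs k).
  { apply Rle_trans with (Rabs (k * barrier_x x)).
    - rewrite <- Rabs_Ropp; apply Rle_abs.
    - rewrite Rabs_mult; rewrite <- (Rmult_1_r (Rabs k)) at 2.
      apply Rmult_le_compat_l; [apply Rabs_pos | assumption]. }
  assert (0 <= lambda * barrier k x y).
  { apply Rmult_le_pos; [assumption | apply Rlt_le, barrier_pos, Ho]. }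
  pose proof (Rabs_pos k); lra.
Qed.

Lemma continuity_2d_barrier (k x y : R) :
  continuity_2d_pt (barrier k) x y.
Proof.
  apply (continuity_2d_pt_plus (fun s _ => sqrt (1 + s ^ 2))
           (fun _ t => (1 + Rabs k) * (t * (PI - t)))).
  - apply (continuity_1d_2d_pt_comp (fun s => sqrt (1 + s ^ 2)) (fun s _ => s)).
    + apply continuity_pt_filterlim.
      apply (ex_derive_continuous (fun s : R => sqrt (1 + s ^ 2))).
      auto_derive; pose proof (pow2_ge_0 x); simpl in *; lra.
    + apply continuity_2d_pt_id1.
  - apply (continuity_1d_2d_pt_comp
             (fun t => (1 + Rabs k) * (t * (PI - t))) (fun _ t => t)).
    + apply continuity_pt_filterlim.
      apply (ex_derive_continuous (fun t : R => (1 + Rabs k) * (t * (PI - t)))).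
      auto_derive; exact I.
    + apply continuity_2d_pt_id2.
Qed.

(** * The comparison principle *)

(** Gathers the one-dimensional derivatives hidden in the class C^2, with the
    first-order ones valid nearby, as the second-derivative test needs. *)
Lemma C2_Omega_derivatives (u : R -> R -> R) (x y : R) :
  C2_Omega u -> Omega (x, y) ->
  locally x (fun t => is_derive (fun s => u s y) t (partial_derive 1 0 u t y)) /\
  locally y (fun t => is_derive (u x) t (partial_derive 0 1 u x t)) /\
  is_derive (fun t => partial_derive 1 0 u t y) x (partial_derive 2 0 u x y) /\
  is_derive (partial_derive 0 1 u x) y (partial_derive 0 2 u x y).
Proof.
  intros Hu Ho.
  split; [|split; [|split]].
  - apply filter_forall; intros t.
    apply (Derive_correct (fun s => u s y)).
    apply (Hu t y Ho).
  - apply (filter_imp (fun t => 0 < t < PI)).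
    + intros t Ht; apply (Derive_correct (u x)).
      apply (Hu x t Ht).
    + destruct Ho as [H0 H1]; cbn [snd] in *.
      apply filter_and; [apply (open_gt 0 y H0) | apply (open_lt PI y H1)].
  - apply (Derive_correct (fun t => partial_derive 1 0 u t y)).
    apply (Hu x y Ho).
  - apply (Derive_correct (partial_derive 0 1 u x)).
    apply (Hu x y Ho).
Qed.

Definition elliptic_op (k lambda : R) (u : R -> R -> R) (x y : R) : R :=
  Laplacian u x y - k * partial_derive 1 0 u x y - lambda * u x y.

Lemma is_derive_perturbed (f g h : R -> R) (x df dg dh eps : R) :
  is_derive f x df -> is_derive g x dg -> is_derive h x dh ->
  is_derive (fun t => f t - g t - eps * h t) x (df - dg - eps * dh).
Proof.
  intros Hf Hg Hh.
  apply (is_derive_minus (fun t => f t - g t) (fun t => eps * h t)).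
  - apply (is_derive_minus f g); assumption.
  - apply (is_derive_scal h x eps dh), Hh.
Qed.

(** [u - v - eps phi] is strictly negative at infinity, the growth of the
    barrier absorbing that of [u] and [v]. *)
Lemma perturbed_neg_at_infinity (k eps : R) (u v : R -> R -> R) :
  0 < eps -> sublinear_at_infinity u -> sublinear_at_infinity v ->
  exists M, forall x y, Omega_bar (x, y) -> M < Rabs x ->
    u x y - v x y - eps * barrier k x y < 0.
Proof.
  intros He Hu Hv.
  (* Two functions, each at most [eps/8] times the distance, and the distance
     at most four times the barrier. *)
  destruct (Hu (eps / 8)) as [Mu HMu]; [lra|].
  destruct (Hv (eps / 8)) as [Mv HMv]; [lra|].
  exists (Rmax 0 (Rmax Mu Mv)); intros x y Ho Hx.
  pose proof (Rmax_l 0 (Rmax Mu Mv)); pose proof (Rmax_r 0 (Rmax Mu Mv)).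
  pose proof (Rmax_l Mu Mv); pose proof (Rmax_r Mu Mv).
  assert (Hr : Rabs x <= sqrt (x ^ 2 + y ^ 2)).
  { rewrite <- sqrt_Rsqr_abs; apply sqrt_le_1_alt.
    pose proof (pow2_ge_0 y); unfold Rsqr; simpl in *; lra. }
  specialize (HMu x y Ho); specialize (HMv x y Ho).
  pose proof (dist_le_barrier k x y Ho) as Hb.
  set (r := sqrt (x ^ 2 + y ^ 2)) in *.
  assert (Hr0 : 0 < r) by lra.
  assert (Hu1 : Rabs (u x y / r) < eps / 8) by (apply HMu; lra).
  assert (Hv1 : Rabs (v x y / r) < eps / 8) by (apply HMv; lra).
  apply Rabs_lt_between in Hu1; apply Rabs_lt_between in Hv1.
  assert (Hu2 : u x y < eps / 8 * r) by (apply Rlt_div_l; lra).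
  assert (Hv2 : - (eps / 8) * r < v x y) by (apply Rlt_div_r; lra).
  assert (eps * r <= eps * (4 * barrier k x y)).
  { apply Rmult_le_compat_l; lra. }
  lra.
Qed.

Lemma continuous_on_perturbed (k eps : R) (u v : R -> R -> R)
    (D : R * R -> Prop) :
  continuous_on_2d D u -> continuous_on_2d D v ->
  continuous_on_2d D (fun x y => u x y - v x y - eps * barrier k x y).
Proof.
  intros Hu Hv [x y] Hp.
  specialize (Hu _ Hp); specialize (Hv _ Hp).
  apply filterlim_locally; intros e.
  assert (He3 : 0 < e / 3) by (pose proof (cond_pos e); lra).
  apply (proj1 (filterlim_locally _ _)) with (eps := mkposreal _ He3) in Hu.
  apply (proj1 (filterlim_locally _ _)) with (eps := mkposreal _ He3) in Hv.
  assert (Hb : continuity_2d_pt (fun s t => eps * barrier k s t) x y).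
  { apply (continuity_2d_pt_mult (fun _ _ => eps) (barrier k)).
    - apply continuity_2d_pt_const.
    - apply continuity_2d_barrier. }
  specialize (Hb (mkposreal _ He3)).
  apply locally_2d_locally in Hb.
  assert (Hb' : within D (locally (x, y)) (fun z =>
    Rabs (eps * barrier k (fst z) (snd z) - eps * barrier k x y) < e / 3)).
  { apply (filter_imp (F := locally (x, y))) with (2 := Hb).
    intros z Hz _; exact Hz. }
  generalize (filter_and _ _ Hu (filter_and _ _ Hv Hb')).
  apply filter_imp; intros [s t] [H1 [H2 H3]].
  change (Rabs (u s t - u x y) < e / 3) in H1.
  change (Rabs (v s t - v x y) < e / 3) in H2.
  change (Rabs (eps * barrier k s t - eps * barrier k x y) < e / 3) in H3.
  change (Rabs ((u s t - v s t - eps * barrier k s t)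
                - (u x y - v x y - eps * barrier k x y)) < e).
  apply Rabs_lt_between in H1; apply Rabs_lt_between in H2.
  apply Rabs_lt_between in H3; apply Rabs_lt_between; lra.
Qed.

(** With [z = u - v - eps phi], the test at a maximum gives [L z <= 0], while
    [L phi < 0] makes [L z] positive. Only maximality along the two coordinate
    lines matters, since [L] has no mixed derivative. *)
Lemma no_interior_max (k lambda eps : R) (u v : R -> R -> R) (x y : R) :
  0 <= lambda -> 0 < eps -> C2_Omega u -> C2_Omega v -> Omega (x, y) ->
  elliptic_op k lambda v x y <= elliptic_op k lambda u x y ->
  let z s t := u s t - v s t - eps * barrier k s t in
  0 <= z x y ->
  locally x (fun s => z s y <= z x y) ->
  locally y (fun t => z x t <= z x y) ->
  False.
Proof.
  intros Hl He Hu Hv Ho Hop z Hz Hmx Hmy.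
  destruct (C2_Omega_derivatives u x y Hu Ho) as [Ux [Uy [Uxx Uyy]]].
  destruct (C2_Omega_derivatives v x y Hv Ho) as [Vx [Vy [Vxx Vyy]]].
  destruct (second_derivative_at_max (fun s => z s y)
    (fun s => partial_derive 1 0 u s y - partial_derive 1 0 v s y
              - eps * barrier_x s) x
    (partial_derive 2 0 u x y - partial_derive 2 0 v x y - eps * barrier_xx x))
    as [Ex Lx].
  { generalize (filter_and _ _ Ux Vx); apply filter_imp; intros s [H1 H2].
    apply (is_derive_perturbed (fun s => u s y) (fun s => v s y)
             (fun s => barrier k s y)); auto using is_derive_barrier_x. }
  { apply is_derive_perturbed; auto using is_derive_barrier_xx. }
  { exact Hmx. }
  destruct (second_derivative_at_max (fun t => z x t)
    (fun t => partial_derive 0 1 u x t - partial_derive 0 1 v x t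
              - eps * barrier_y k t) y
    (partial_derive 0 2 u x y - partial_derive 0 2 v x y
     - eps * (- 2 * (1 + Rabs k)))) as [_ Ly].
  { generalize (filter_and _ _ Uy Vy); apply filter_imp; intros t [H1 H2].
    apply (is_derive_perturbed (u x) (v x) (barrier k x));
      auto using is_derive_barrier_y. }
  { apply is_derive_perturbed; auto using is_derive_barrier_yy. }
  { exact Hmy. }
  assert (Hb : Omega_bar (x, y)) by (destruct Ho; split; simpl in *; lra).
  pose proof (barrier_strict k lambda x y Hl Hb) as Hs.
  apply (Rmult_lt_compat_l eps) in Hs; [|assumption].
  assert (Hlz : 0 <= lambda * z x y) by (apply Rmult_le_pos; assumption).
  assert (Ekx : k * (partial_derive 1 0 u x y - partial_derive 1 0 v x y
                     - eps * barrier_x x) = 0) by (rewrite Ex; ring).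
  unfold elliptic_op, Laplacian in Hop; unfold z in Hlz.
  lra.
Qed.

Lemma comparison (k lambda : R) (u v : R -> R -> R) :
  0 <= lambda -> sublinear_class u -> sublinear_class v ->
  (forall x y, Omega (x, y) ->
     elliptic_op k lambda v x y <= elliptic_op k lambda u x y) ->
  (forall x, u x 0 <= v x 0 /\ u x PI <= v x PI) ->
  forall x y, Omega_bar (x, y) -> u x y <= v x y.
Proof.
  intros Hl [Hu2 [Huc Hus]] [Hv2 [Hvc Hvs]] Hop Hbd x0 y0 H0.
  destruct (Rle_or_lt (u x0 y0) (v x0 y0)) as [|Hpos]; [assumption | exfalso].
  pose proof (barrier_pos k x0 y0 H0) as Hb0.
  (* Small enough for [u - v - eps phi] to keep half of the excess at the
     given point. *)
  pose (eps := (u x0 y0 - v x0 y0) / (2 * barrier k x0 y0)).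
  assert (He : 0 < eps) by (apply Rdiv_lt_0_compat; lra).
  pose (z := fun x y => u x y - v x y - eps * barrier k x y).
  assert (Hz0 : 0 < z x0 y0).
  { unfold z, eps.
    replace (_ - _) with ((u x0 y0 - v x0 y0) / 2) by (field; lra); lra. }
  destruct (perturbed_neg_at_infinity k eps u v He Hus Hvs) as [M HM].
  pose (A := Rmax (Rabs x0) (Rmax M 0) + 1).
  assert (HA : Rabs x0 < A /\ M < A /\ 0 < A).
  { unfold A, Rmax; repeat destruct Rle_dec; lra. }
  pose proof PI_RGT_0 as Hpi.
  destruct (rectangle_max_attained z (- A) A 0 PI) as [x1 [y1 [Hx1 [Hy1 Hm]]]];
    [lra | lra | |].
  { apply (continuous_on_subset Omega_bar).
    - intros p Hp; apply Hp.
    - apply continuous_on_perturbed; assumption. }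
  assert (Hz1 : 0 < z x1 y1).
  { apply Rlt_le_trans with (1 := Hz0), Hm; [|exact H0].
    apply Rabs_le_between; lra. }
  assert (Hx1' : - A < x1 < A).
  { apply Rabs_lt_between.
    destruct (Rlt_or_le (Rabs x1) A) as [|HAx]; [assumption|].
    assert (z x1 y1 < 0) by (apply HM; [exact Hy1 | lra]); lra. }
  assert (Hz_edge : forall y, 0 <= y <= PI -> u x1 y <= v x1 y -> z x1 y < 0).
  { intros y Hy Huv.
    assert (0 < eps * barrier k x1 y).
    { apply Rmult_lt_0_compat; [assumption | apply barrier_pos, Hy]. }
    unfold z; lra. }
  assert (Hy1' : 0 < y1 < PI).
  { destruct (Hbd x1) as [Hb Ht].
    split; apply Rnot_le_lt; intros Hy.
    - assert (y1 = 0) by lra; subst y1; apply Hz_edge in Hb; lra.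
    - assert (y1 = PI) by lra; subst y1; apply Hz_edge in Ht; lra. }
  apply (no_interior_max k lambda eps u v x1 y1 Hl He Hu2 Hv2 Hy1').
  - apply Hop, Hy1'.
  - apply Rlt_le, Hz1.
  - apply (filter_imp (fun s => - A < s < A)).
    + intros s Hs; apply Hm; lra.
    + apply filter_and; [apply (open_gt (- A)) | apply (open_lt A)]; lra.
  - apply (filter_imp (fun t => 0 < t < PI)).
    + intros t Ht; apply Hm; lra.
    + apply filter_and; [apply (open_gt 0) | apply (open_lt PI)]; lra.
Qed.

(** * Uniqueness *)

Lemma bounded_sublinear (u : R -> R -> R) :
  bounded_on_2d Omega_bar u -> sublinear_at_infinity u.
Proof.
  intros [B HB] eps He.
  (* The maximum with 0 keeps the distance away from 0. *)
  exists (Rmax 0 (B / eps)); intros x y Ho Hr.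
  specialize (HB x y Ho).
  pose proof (Rmax_l 0 (B / eps)); pose proof (Rmax_r 0 (B / eps)).
  set (r := sqrt (x ^ 2 + y ^ 2)) in *.
  rewrite Rabs_div, (Rabs_pos_eq r) by lra.
  apply Rlt_div_l; [lra|].
  assert (HBr : B / eps < r) by lra.
  apply Rlt_div_l in HBr; lra.
Qed.

Lemma unique_in_sublinear_class (f : R -> R -> R) (g h : R -> R)
    (k lambda : R) :
  0 <= lambda -> at_most_one_in sublinear_class (solves k lambda f g h).
Proof.
  intros Hl u v Cu [Eu Bu] Cv [Ev Bv] x y Ho.
  apply Rle_antisym; apply (comparison k lambda); try assumption.
  - intros s t Hst; unfold elliptic_op; rewrite Eu, Ev by assumption; lra.
  - intros s; destruct (Bu s), (Bv s); lra.
  - intros s t Hst; unfold elliptic_op; rewrite Eu, Ev by assumption; lra.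
  - intros s; destruct (Bu s), (Bv s); lra.
Qed.

Theorem theorem2p2 (f : R -> R -> R) (g h : R -> R) (k lambda : R)
  (hf : continuous_on_2d Omega f)
  (hg : forall x : R, continuous g x)
  (hh : forall x : R, continuous h x)
  (hlambda : 0 <= lambda) :
  at_most_one_in sublinear_class (solves k lambda f g h) /\
  at_most_one_in bounded_class (solves k lambda f g h).
Proof.
  pose proof (unique_in_sublinear_class f g h k lambda hlambda) as Huniq.
  split; [exact Huniq|].
  intros u v [Cu [Ku Bu]] Su [Cv [Kv Bv]] Sv.
  apply Huniq; try assumption.
  - exact (conj Cu (conj Ku (bounded_sublinear u Bu))).
  - exact (conj Cv (conj Kv (bounded_sublinear v Bv))).
Qed.
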